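(* Let $\alpha\in\mathbb{C}\setminus\{-1,-2,\dotsc\}$, let $z\in\mathbb{C}$ with $|z|\le1$, and let $n\ge1$ be an integer. Then $$\sum_{k=1}^{n}\binom{2k}{k}\frac{1}{\alpha+k}\Bigl(\frac{z}{4}\Bigr)^k=-\frac{(1+2n)!!}{(2+2n)!!}\,\frac{z^{1+n}}{1+\alpha+n}\,{}_3F_2\bigl(1,\tfrac32+n,1+\alpha+n;2+n,2+\alpha+n;z\bigr)+E(\alpha,z),$$ where $$E(\alpha,z)=\begin{cases}\dfrac{1}{\alpha}\Bigl({}_2F_1\bigl(\tfrac12,\alpha;1+\alpha;z\bigr)-1\Bigr), & \alpha\ne0,\\[2mm] 2\ln\dfrac{2}{1+\sqrt{1-z}}, & \alpha=0.\end{cases}$$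
   Context: The generalized hypergeometric function is ${}_pF_q(a_1,\dotsc,a_p;b_1,\dotsc,b_q;z)=\sum_{m=0}^{\infty}\frac{(a_1)_m\dotsm(a_p)_m}{(b_1)_m\dotsm(b_q)_m}\frac{z^m}{m!}$, where $(a)_0=1$ and $(a)_m=a(a+1)\dotsm(a+m-1)$ for $m\ge1$; all hypergeometric series in the claim converge for $|z|\le1$. $m!!$ is the double factorial, the product $m(m-2)(m-4)\dotsm$ ending in $1$ or $2$. The square root and logarithm are principal branches. *)

(* Defs.v *)
From Stdlib Require Import Reals Factorial List.
From Coquelicot Require Import Coquelicot.
Import ListNotations.

Open Scope C_scope.

(* Rising factorial (a)_m = a (a + 1) ... (a + m - 1). *)
Fixpoint poch (a : C) (m : nat) : C :=
  match m with
  | O => 1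
  | S m' => poch a m' * (a + INR m')
  end.

Definition Cprod (l : list C) : C := fold_right Cmult (RtoC 1) l.

Definition hypergeom_term (aa bb : list C) (z : C) (m : nat) : C :=
  Cprod (map (fun a => poch a m) aa) / Cprod (map (fun b => poch b m) bb)
  * (z ^ m / INR (fact m)).

Definition hypergeom_converges (aa bb : list C) (z : C) : Prop :=
  ex_series (hypergeom_term aa bb z).

(* pFq(aa; bb; z) with p = length aa, q = length bb.  The value is unspecified
   where the series diverges. *)
Definition hypergeom (aa bb : list C) (z : C) : C :=
  iota (T := C_CompleteNormedModule) (is_series (hypergeom_term aa bb z)).

(* n!!, with the convention 0!! = 1. *)
Fixpoint double_fact (n : nat) : nat :=
  match n with
  | S (S m as p) => S p * double_fact m
  | _ => 1
  end.

(* Principal argument, in (-PI, PI]; meaningless at 0. *)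
Definition Carg (z : C) : R :=
  if Rlt_dec (Im z) 0 then (- acos (Re z / Cmod z))%R
  else acos (Re z / Cmod z).

(* Principal branches, cut along the negative real axis, whose points take the
   limit value from above.  At 0, Csqrt is 0 whatever Carg 0 is, and Cln is
   meaningless. *)
Definition Csqrt (z : C) : C :=
  sqrt (Cmod z) * (cos (Carg z / 2), sin (Carg z / 2)).

Definition Cln (z : C) : C := (ln (Cmod z), Carg z).

Definition E (alpha z : C) : C :=
  if Ceq_dec alpha 0 then 2 * Cln (2 / (1 + Csqrt (1 - z)))
  else 1 / alpha * (hypergeom [RtoC (1 / 2); alpha] [1 + alpha] z - 1).

(* Main.v *)
(* With c_k = binom(2k,k)/4^k, the m-th term of the 3F2 series times its prefactor
   is c_j z^j/(alpha+j) for j = n+1+m, and the m-th term of the 2F1 series is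
   alpha c_m z^m/(alpha+m); the claim says that a convergent series splits into a
   finite sum and a remainder.  Convergence for |z| <= 1 is absolute because
   c_k - c_{k+1} = c_k/(2(k+1)) telescopes.
   For alpha = 0 the sum over k >= 1 of c_k z^k/k has to be evaluated up to the
   circle |z| = 1.  Along the ray t z, 0 <= t < 1, the series of c_k (tz)^k
   satisfies the differential equation of 1/sqrt(1-tz), hence equals it, so the
   logarithmic series and 2 ln(2/(1+sqrt(1-tz))) have the same derivative in t;
   Abel's theorem gives the value at t = 1. *)
Require Import Defs.
From Stdlib Require Import Reals Factorial List Lra Lia FunctionalExtensionality.
From Coquelicot Require Import Coquelicot.
Import ListNotations.

Open Scope C_scope.

(** * The coefficients c_k *)

(** These are the Taylor coefficients of 1/sqrt(1-x) at 0. *)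
Definition central (k : nat) : R := (Binomial.C (2 * k) k / 4 ^ k)%R.

Lemma central_0 : central 0 = 1%R.
Proof. unfold central; rewrite Nat.mul_0_r, C_n_0; simpl; field. Qed.

Lemma central_S (k : nat) :
  central (S k) = (central k * ((2 * INR k + 1) / (2 * INR k + 2)))%R.
Proof.
  unfold central, Binomial.C.
  replace (2 * S k - S k)%nat with (S k) by lia.
  replace (2 * k - k)%nat with k by lia.
  replace (2 * S k)%nat with (S (S (2 * k))) by lia.
  rewrite !fact_simpl, !mult_INR, !S_INR, mult_INR; simpl (INR 2); simpl pow.
  pose proof (INR_fact_neq_0 k); pose proof (pos_INR k).
  assert (4 ^ k <> 0)%R by (apply pow_nonzero; lra).
  field; repeat split; lra.
Qed.

Lemma central_pos (k : nat) : (0 < central k)%R.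
Proof.
  induction k as [|k IH]; [rewrite central_0; lra|].
  rewrite central_S; pose proof (pos_INR k).
  apply Rmult_lt_0_compat, Rdiv_lt_0_compat; lra.
Qed.

Lemma central_le_1 (k : nat) : (central k <= 1)%R.
Proof.
  induction k as [|k IH]; [rewrite central_0; lra|].
  rewrite central_S; pose proof (pos_INR k); pose proof (central_pos k).
  assert ((2 * INR k + 1) / (2 * INR k + 2) <= 1)%R
    by (apply Rle_div_l; lra).
  assert (0 < (2 * INR k + 1) / (2 * INR k + 2))%R
    by (apply Rdiv_lt_0_compat; lra).
  nra.
Qed.

(* The sum telescopes: [central k / (2 (k + 1)) = central k - central (k + 1)]. *)
Lemma ex_series_central_div_succ :
  ex_series (fun k : nat => (central k / (INR k + 1))%R).
Proof.
  apply (ex_series_ext (fun k => scal 2%R (central k - central (S k))%R)).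
  { intros k; change (2 * (central k - central (S k)) = central k / (INR k + 1))%R.
    rewrite central_S; pose proof (pos_INR k); field; lra. }
  apply (ex_series_scal (K := R_AbsRing) (V := R_NormedModule)).
  destruct (ex_finite_lim_seq_decr central 0) as [l Hl].
  { intros k; rewrite central_S; pose proof (pos_INR k); pose proof (central_pos k).
    assert ((2 * INR k + 1) / (2 * INR k + 2) <= 1)%R by (apply Rle_div_l; lra).
    nra. }
  { intros k; apply Rlt_le, central_pos. }
  exists (1 - l)%R.
  change (is_lim_seq (sum_n (fun k => (central k - central (S k))%R)) (1 - l)%R).
  apply is_lim_seq_ext with (fun k => (1 - central (S k))%R).
  { induction n as [|n IH].
    - rewrite sum_O, central_0; reflexivity.
    - rewrite sum_Sn, <- IH; unfold plus; simpl; ring. }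
  apply is_lim_seq_minus'; [apply is_lim_seq_const|].
  now apply is_lim_seq_incr_1 with (u := central).
Qed.

(** * Rising and double factorials in terms of c_k *)

(** The new factor 1/2 + m is (m+1) times the ratio (2m+1)/(2m+2) of [central_S]. *)
Lemma poch_half_div_fact (m : nat) :
  poch (RtoC (1 / 2)) m = central m * INR (fact m).
Proof.
  induction m as [|m IH]; simpl poch.
  - rewrite central_0; simpl; ring.
  - rewrite IH, central_S, fact_simpl, mult_INR, S_INR.
    rewrite <- !RtoC_mult, <- RtoC_plus, <- RtoC_mult; f_equal.
    pose proof (pos_INR m); field; lra.
Qed.

Lemma double_fact_neq_0 (n : nat) : double_fact n <> 0%nat.
Proof.
  (* [double_fact] recurses in steps of two, so the induction carries two consecutive values. *)
  enough (double_fact n <> 0%nat /\ double_fact (S n) <> 0%nat) by tauto.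
  induction n as [|n [H1 H2]]; [simpl; lia|split; [exact H2|simpl; lia]].
Qed.

(** Identifies the prefactor of the 3F2: raising n by 1 multiplies the quotient by (2n+3)/(2n+4),
    which is c_{n+2}/c_{n+1}. *)
Lemma double_fact_ratio (n : nat) :
  (INR (double_fact (1 + 2 * n)) / INR (double_fact (2 + 2 * n)))%R
  = central (S n).
Proof.
  induction n as [|n IH].
  - rewrite central_S, central_0; simpl; field.
  - rewrite central_S, <- IH.
    replace (1 + 2 * S n)%nat with (S (S (1 + 2 * n))) by lia.
    replace (2 + 2 * S n)%nat with (S (S (2 + 2 * n))) by lia.
    assert (forall m, double_fact (S (S m)) = (S (S m) * double_fact m)%nat) as E
      by reflexivity.
    rewrite (E (1 + 2 * n)%nat), (E (2 + 2 * n)%nat), !mult_INR, !S_INR.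
    assert (INR (double_fact (2 + 2 * n)) <> 0)%R
      by (apply not_0_INR, double_fact_neq_0).
    rewrite !plus_INR, !mult_INR; simpl (INR 1); simpl (INR 2).
    pose proof (pos_INR n); field; repeat split; lra.
Qed.

Lemma poch_1 (m : nat) : poch 1 m = INR (fact m).
Proof.
  induction m as [|m IH]; simpl poch; [reflexivity|].
  rewrite IH, fact_simpl, mult_INR, S_INR, RtoC_mult, RtoC_plus; ring.
Qed.

(** Both sides are a (a+1) ... (a+m), split at its first or at its last factor. It collapses
    quotients of rising factorials whose parameters differ by 1. *)
Lemma poch_succ (a : C) (m : nat) : a * poch (1 + a) m = poch a m * (a + INR m).
Proof.
  induction m as [|m IH]; simpl poch; [simpl; ring|].
  rewrite Cmult_assoc, IH, S_INR, RtoC_plus; ring.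
Qed.

Lemma poch_neq_0 (a : C) (m : nat) :
  (forall j : nat, a + INR j <> 0) -> poch a m <> 0.
Proof.
  intros Ha; induction m as [|m IH]; simpl poch.
  - intros H; apply (f_equal fst) in H; simpl in H; lra.
  - now apply Cmult_neq_0.
Qed.

Lemma nat_plus_INR_neq_0 (n j : nat) : 2 + INR n + INR j <> 0.
Proof.
  rewrite <- !RtoC_plus; intros H; apply (f_equal fst) in H; simpl in H.
  pose proof (pos_INR n); pose proof (pos_INR j); lra.
Qed.

(** With k = n+1+m, the quotient (3/2+n+m)/(2+n+m) is c_{k+1}/c_k, so each step in m advances the
    index of c by one. *)
Lemma central_shift (n m : nat) :
  RtoC (central (S n)) * poch (3 / 2 + INR n) m
  = central (S n + m) * poch (2 + INR n) m.
Proof.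
  induction m as [|m IH]; simpl poch.
  - now rewrite Nat.add_0_r.
  - rewrite Cmult_assoc, IH, Nat.add_succ_r, central_S.
    rewrite plus_INR, S_INR.
    pose proof (pos_INR n); pose proof (pos_INR m).
    replace (3 / 2 + INR n + INR m) with (RtoC (3 / 2 + INR n + INR m))
      by (rewrite !RtoC_plus, RtoC_div; [reflexivity|lra]).
    replace (poch (2 + INR n) m * (2 + INR n + INR m))
      with (poch (2 + INR n) m * RtoC (2 + INR n + INR m))
      by (rewrite !RtoC_plus; reflexivity).
    rewrite RtoC_mult.
    replace (3 / 2 + INR n + INR m)%R
      with ((2 * (INR n + 1 + INR m) + 1) / (2 * (INR n + 1 + INR m) + 2)
            * (2 + INR n + INR m))%R by (field; lra).
    rewrite RtoC_mult; ring.
Qed.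

(** * Convergence on the closed unit disc *)

(** From some index p on, the terms are dominated by 4 c_p/(p+1), whose sum is finite by
    telescoping; the finitely many earlier terms do not affect convergence. *)
Lemma ex_series_tail (alpha z : C) (N : nat) : (Cmod z <= 1)%R ->
  ex_series (fun m : nat =>
    central (N + m) / (alpha + INR (N + m)) * z ^ m).
Proof.
  intros Hz.
  (* For p > 2|alpha|+1 the triangle inequality gives |alpha+p| >= p - |alpha| > (p+1)/2, which
     covers the bound (p+1)/4 below and excludes a zero denominator. *)
  destruct (INR_unbounded (2 * Cmod alpha + 1)) as [K HK].
  apply (ex_series_incr_n _ K).
  apply (ex_series_le (K := C_AbsRing) (V := C_CompleteNormedModule)) with
    (fun m => (4 * (central (N + K + m) / (INR (N + K + m) + 1)))%R).
  - intros m; rewrite Nat.add_assoc.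
    set (p := (N + K + m)%nat).
    assert (2 * Cmod alpha + 1 < INR p)%R.
    { apply Rlt_le_trans with (1 := HK), le_INR; unfold p; lia. }
    pose proof (Cmod_ge_0 alpha).
    assert ((INR p + 1) / 4 <= Cmod (alpha + INR p))%R.
    { replace (RtoC (INR p)) with ((alpha + INR p) + - alpha) by ring.
      pose proof (Cmod_triangle (alpha + INR p) (- alpha)) as HT.
      replace (alpha + INR p + - alpha) with (RtoC (INR p)) in HT |- * by ring.
      rewrite Cmod_R, Cmod_opp, Rabs_pos_eq in HT by lra; lra. }
    change (Cmod (central p / (alpha + INR p) * z ^ (K + m))
            <= 4 * (central p / (INR p + 1)))%R.
    pose proof (central_pos p).
    rewrite Cmod_mult, Cmod_div, Cmod_pow, Cmod_R, Rabs_pos_eq by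
      (try (intros E0; rewrite E0, Cmod_0 in *); lra).
    assert (Cmod z ^ (K + m) <= 1)%R.
    { rewrite <- (pow1 (K + m)); apply pow_incr; split; [apply Cmod_ge_0|lra]. }
    assert (0 <= Cmod z ^ (K + m))%R by apply pow_le, Cmod_ge_0.
    assert (central p / Cmod (alpha + INR p) <= 4 * (central p / (INR p + 1)))%R.
    { apply Rle_trans with (central p / ((INR p + 1) / 4))%R.
      - unfold Rdiv at 1 2; apply Rmult_le_compat_l, Rinv_le_contravar; lra.
      - right; field; lra. }
    assert (0 <= central p / Cmod (alpha + INR p))%R
      by (apply Rlt_le, Rdiv_lt_0_compat; lra).
    nra.
  - apply (ex_series_scal (K := R_AbsRing) (V := R_NormedModule) 4%R).
    apply (ex_series_incr_n (fun k => (central k / (INR k + 1))%R) (N + K)),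
      ex_series_central_div_succ.
Qed.

(** * Values and terms of the hypergeometric series *)

Lemma is_series_C_unique (a : nat -> C) (l l' : C) :
  is_series a l -> is_series a l' -> l = l'.
Proof. apply filterlim_locally_unique; apply eventually_filter. Qed.

(** [hypergeom] is a definite description; uniqueness of sums turns it into the sum. *)
Lemma hypergeom_unique (aa bb : list C) (z l : C) :
  is_series (hypergeom_term aa bb z) l -> hypergeom aa bb z = l.
Proof.
  intros H; apply (iota_unique (K := C_AbsRing) (V := C_CompleteNormedModule)); [|exact H].
  intros y Hy; now apply is_series_C_unique with (hypergeom_term aa bb z).
Qed.

(** Here (1/2)_m/m! = c_m, and (alpha)_m/(1+alpha)_m collapses to alpha/(alpha+m). The form [0 + m]
    matches [ex_series_tail] with N = 0. *)
Lemma hypergeom_term_2F1 (alpha z : C) (m : nat) :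
  (forall j : nat, (1 <= j)%nat -> alpha <> - INR j) -> alpha <> 0 ->
  hypergeom_term [RtoC (1 / 2); alpha] [1 + alpha] z m
  = alpha * (central (0 + m) / (alpha + INR (0 + m)) * z ^ m).
Proof.
  intros Ha Ha0.
  assert (forall j : nat, alpha + INR j <> 0) as Hnz.
  { intros [|j] H; [apply Ha0; rewrite <- H; simpl; ring|].
    apply (Ha (S j)); [lia|].
    replace alpha with (alpha + INR (S j) - INR (S j)) by ring.
    rewrite H; ring. }
  unfold hypergeom_term; simpl map;
  unfold Cprod; simpl fold_right.
  rewrite poch_half_div_fact.
  assert (poch (1 + alpha) m = poch alpha m * (alpha + INR m) / alpha) as E1
    by (rewrite <- poch_succ; field; auto).
  rewrite E1.
  pose proof (poch_neq_0 alpha m Hnz).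
  assert (RtoC (INR (fact m)) <> 0)
    by (intros H'; apply RtoC_inj in H'; now apply (INR_fact_neq_0 m)).
  change (0 + m)%nat with m.
  field; repeat split; auto.
Qed.

(** (1)_m cancels m!, the parameters containing alpha collapse by [poch_succ], and the remaining
    quotient together with c_{n+1} is [central_shift]. *)
Lemma hypergeom_term_3F2 (alpha z : C) (n m : nat) :
  (forall j : nat, (1 <= j)%nat -> alpha <> - INR j) ->
  RtoC (central (S n)) * hypergeom_term
    [RtoC 1; 3 / 2 + INR n; 1 + alpha + INR n]
    [2 + INR n; 2 + alpha + INR n] z m
  = (1 + alpha + INR n) *
    (central (S n + m) / (alpha + INR (S n + m)) * z ^ m).
Proof.
  intros Ha.
  assert (forall j : nat, (1 <= j)%nat -> alpha + INR j <> 0) as Hnz.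
  { intros j Hj H; apply (Ha j Hj).
    replace alpha with (alpha + INR j - INR j) by ring.
    rewrite H; ring. }
  assert (forall j : nat, 1 + alpha + INR n + INR j = alpha + INR (S n + j)) as E0.
  { intros j; rewrite plus_INR, S_INR, !RtoC_plus; ring. }
  unfold hypergeom_term; simpl map.
  unfold Cprod; simpl fold_right.
  assert (poch (2 + alpha + INR n) m = poch (1 + alpha + INR n) m
     * (1 + alpha + INR n + INR m) / (1 + alpha + INR n)) as E1.
  { rewrite <- poch_succ.
    replace (1 + (1 + alpha + INR n)) with (2 + alpha + INR n) by ring.
    field.
    pose proof (Hnz (S n + 0)%nat) as H0; rewrite <- E0 in H0; simpl in H0.
    replace (1 + alpha + INR n + 0) with (1 + alpha + INR n) in H0 by ring.
    apply H0; lia. }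
  rewrite E1, poch_1, <- E0.
  assert (poch (1 + alpha + INR n) m <> 0).
  { apply poch_neq_0; intros j; rewrite E0; apply Hnz; lia. }
  assert (1 + alpha + INR n + INR m <> 0) by (rewrite E0; apply Hnz; lia).
  assert (1 + alpha + INR n <> 0).
  { pose proof (Hnz (S n + 0)%nat) as H1; rewrite <- E0 in H1; simpl in H1.
    replace (1 + alpha + INR n + 0) with (1 + alpha + INR n) in H1 by ring.
    apply H1; lia. }
  assert (poch (2 + INR n) m <> 0)
    by (apply poch_neq_0; intros j; apply nat_plus_INR_neq_0).
  assert (RtoC (INR (fact m)) <> 0)
    by (intros H'; apply RtoC_inj in H'; now apply (INR_fact_neq_0 m)).
  transitivity (RtoC (central (S n)) * poch (3 / 2 + INR n) m
    / poch (2 + INR n) m * (1 + alpha + INR n) / (1 + alpha + INR n + INR m) * z ^ m).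
  - field; repeat split; auto.
  - rewrite central_shift; field; repeat split; auto.
Qed.

(** * Complex series through real and imaginary parts *)

Lemma is_series_pair (a : nat -> C) (x y : R) :
  is_series (fun k => fst (a k)) x -> is_series (fun k => snd (a k)) y ->
  is_series a ((x, y) : C).
Proof.
  intros Hx Hy.
  assert (forall n, sum_n a n =
     (sum_n (fun k => fst (a k)) n, sum_n (fun k => snd (a k)) n)) as E.
  { induction n as [|n IH]; [rewrite !sum_O; apply surjective_pairing|].
    rewrite !sum_Sn, IH; reflexivity. }
  unfold is_series.
  apply filterlim_ext with
    (fun n => (sum_n (fun k => fst (a k)) n, sum_n (fun k => snd (a k)) n)).
  { intros n; symmetry; apply E. }
  (* A neighbourhood of (x, y) contains a product of two balls of equal radius, which the product
     filter of the two limits can reach. *)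
  intros P HP.
  apply (filterlim_pair _ _ Hx Hy).
  destruct HP as [eps HP].
  exists (ball x eps) (ball y eps); [apply locally_ball|apply locally_ball|].
  intros u v Hu Hv; apply HP; now split.
Qed.

Lemma is_series_fst (a : nat -> C) (l : C) :
  is_series a l -> is_series (fun k => fst (a k)) (fst l).
Proof.
  intros H; unfold is_series.
  apply filterlim_ext with (fun n => fst (sum_n a n)).
  { induction x as [|n IH]; [now rewrite !sum_O|].
    rewrite !sum_Sn, <- IH; reflexivity. }
  apply (filterlim_comp _ _ _ _ _ _ _ _ H).
  apply (continuous_fst (U := R_UniformSpace) (V := R_UniformSpace)).
Qed.

Lemma is_series_snd (a : nat -> C) (l : C) :
  is_series a l -> is_series (fun k => snd (a k)) (snd l).
Proof.
  intros H; unfold is_series.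
  apply filterlim_ext with (fun n => snd (sum_n a n)).
  { induction x as [|n IH]; [now rewrite !sum_O|].
    rewrite !sum_Sn, <- IH; reflexivity. }
  apply (filterlim_comp _ _ _ _ _ _ _ _ H).
  apply (continuous_snd (U := R_UniformSpace) (V := R_UniformSpace)).
Qed.

(** * Derivatives of complex functions of a real variable *)

(** Only derivatives along a ray are needed, so differentiation is componentwise and stays within
    real calculus. *)
Definition is_Cderive (f : R -> C) (t : R) (l : C) : Prop :=
  is_derive (fun x => fst (f x)) t (fst l) /\
  is_derive (fun x => snd (f x)) t (snd l).

Lemma is_Cderive_const (c : C) (t : R) : is_Cderive (fun _ => c) t 0.
Proof. split; apply is_derive_Reals, derivable_pt_lim_const. Qed.

Lemma is_Cderive_minus (f g : R -> C) (t : R) (f' g' : C) :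
  is_Cderive f t f' -> is_Cderive g t g' ->
  is_Cderive (fun x => f x - g x) t (f' - g').
Proof. intros [Hf1 Hf2] [Hg1 Hg2]; split.
  exact (is_derive_minus _ _ _ _ _ Hf1 Hg1).
  exact (is_derive_minus _ _ _ _ _ Hf2 Hg2).
Qed.

Lemma is_Cderive_plus (f g : R -> C) (t : R) (f' g' : C) :
  is_Cderive f t f' -> is_Cderive g t g' ->
  is_Cderive (fun x => f x + g x) t (f' + g').
Proof.
  intros [Hf1 Hf2] [Hg1 Hg2]; split.
  exact (is_derive_plus _ _ _ _ _ Hf1 Hg1).
  exact (is_derive_plus _ _ _ _ _ Hf2 Hg2).
Qed.

(** Replaces a path by an explicit pair of real functions, so that [auto_derive] meets [u] and [v]
    instead of projections. *)
Lemma path_ind (P : (R -> C) -> Prop) :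
  (forall u v : R -> R, P (fun x => (u x, v x))) -> forall f : R -> C, P f.
Proof.
  intros H f.
  replace f with (fun x => (fst (f x), snd (f x)))
    by (extensionality x; symmetry; apply surjective_pairing).
  apply (H (fun x => fst (f x)) (fun x => snd (f x))).
Qed.

Lemma is_Cderive_mult (f g : R -> C) (t : R) (f' g' : C) :
  is_Cderive f t f' -> is_Cderive g t g' ->
  is_Cderive (fun x => f x * g x) t (f' * g t + f t * g').
Proof.
  induction f as [u v] using path_ind; induction g as [p q] using path_ind.
  intros [Hf1 Hf2] [Hg1 Hg2]; simpl in *.
  split; simpl; auto_derive.
  all: try (repeat split; eexists; eassumption).
  all: rewrite (is_derive_unique _ _ _ Hf1), (is_derive_unique _ _ _ Hf2),
    (is_derive_unique _ _ _ Hg1), (is_derive_unique _ _ _ Hg2); ring.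
Qed.

Lemma Cmod2_neq_0 (w : C) : w <> 0 -> (fst w * fst w + snd w * snd w <> 0)%R.
Proof.
  intros Hw H; apply Hw; destruct w as [x y]; simpl in *.
  assert (x = 0 /\ y = 0)%R as [-> ->] by (split; nra); reflexivity.
Qed.

Lemma is_Cderive_inv (f : R -> C) (t : R) (f' : C) :
  is_Cderive f t f' -> f t <> 0 ->
  is_Cderive (fun x => / f x) t (- f' / (f t * f t)).
Proof.
  induction f as [u v] using path_ind.
  intros [H1 H2] H; apply Cmod2_neq_0 in H; simpl in *.
  split; simpl; auto_derive.
  all: try (repeat split; try (now (eexists; eassumption)); intros H0; apply H; lra).
  all: rewrite (is_derive_unique _ _ _ H1), (is_derive_unique _ _ _ H2).
  all: field; split; [nra|]; intros H0; apply H; nra.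
Qed.

(** * Square root and logarithm on the right half plane *)

(* Equal to [Csqrt] and [Cln] on the right half plane, without the case
   distinction in [Carg], hence visibly smooth there. *)
Definition rhp_sqrt (w : C) : C :=
  (sqrt ((sqrt (fst w ^ 2 + snd w ^ 2) + fst w) / 2),
   snd w / (2 * sqrt ((sqrt (fst w ^ 2 + snd w ^ 2) + fst w) / 2)))%R.

Definition rhp_ln (w : C) : C :=
  (ln (sqrt (fst w ^ 2 + snd w ^ 2)), atan (snd w / fst w)).

Lemma sqrt_ge_fst (x y : R) : (0 < x)%R -> (x <= sqrt (x ^ 2 + y ^ 2))%R.
Proof.
  intros Hx; rewrite <- (sqrt_pow2 x) at 1 by lra.
  apply sqrt_le_1_alt; nra.
Qed.

Lemma rhp_sqrt_sqr (w : C) : (0 < fst w)%R -> rhp_sqrt w * rhp_sqrt w = w.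
Proof.
  destruct w as [x y]; unfold rhp_sqrt; cbn [fst snd]; intros Hx.
  pose proof (sqrt_ge_fst x y Hx) as Hge.
  assert (sqrt (x ^ 2 + y ^ 2) * sqrt (x ^ 2 + y ^ 2) = x ^ 2 + y ^ 2)%R as Hm
    by (apply sqrt_sqrt; nra).
  set (m := sqrt (x ^ 2 + y ^ 2)) in *.
  assert (sqrt ((m + x) / 2) * sqrt ((m + x) / 2) = (m + x) / 2)%R as Hp
    by (apply sqrt_sqrt; lra).
  assert (0 < sqrt ((m + x) / 2))%R as Hp0 by (apply sqrt_lt_R0; lra).
  set (p := sqrt ((m + x) / 2)) in *.
  apply injective_projections; simpl.
  (* With p^2 = (m+x)/2 and y^2 = (m-x)(m+x), the square of the imaginary part is (m-x)/2. *)
  - replace (p * p - y / (2 * p) * (y / (2 * p)))%R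
      with (p * p - (y * y) / (4 * (p * p)))%R by (field; lra).
    rewrite Hp; replace (y * y)%R with ((m - x) * (m + x))%R by nra.
    field; lra.
  - field; lra.
Qed.

Lemma rhp_sqrt_pos (w : C) : (0 < fst w)%R -> (0 < fst (rhp_sqrt w))%R.
Proof.
  destruct w as [x y]; cbn; intros Hx; apply sqrt_lt_R0.
  pose proof (sqrt_ge_fst x y Hx); simpl in *; lra.
Qed.

Lemma ex_is_Cderive_rhp_sqrt (f : R -> C) (t : R) (f' : C) :
  is_Cderive f t f' -> (0 < fst (f t))%R ->
  exists l, is_Cderive (fun x => rhp_sqrt (f x)) t l.
Proof.
  induction f as [u v] using path_ind.
  intros [H1 H2] H; cbn [fst snd] in *.
  pose proof (sqrt_ge_fst _ (v t) H) as Hge.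
  assert (0 < sqrt ((sqrt (u t ^ 2 + v t ^ 2) + u t) / 2))%R
    by (apply sqrt_lt_R0; lra).
  assert (0 < u t ^ 2 + v t ^ 2)%R by nra.
  assert (ex_derive (fun x => fst (rhp_sqrt (u x, v x))) t) as [l1 Hl1].
  { unfold rhp_sqrt; cbn [fst snd]; auto_derive.
    repeat split; try (now (eexists; eassumption)); simpl in *; lra. }
  assert (ex_derive (fun x => snd (rhp_sqrt (u x, v x))) t) as [l2 Hl2].
  { unfold rhp_sqrt; cbn [fst snd]; auto_derive.
    repeat split; try (now (eexists; eassumption)); simpl in *; try lra.
     }
  now exists (l1, l2).
Qed.

Lemma is_Cderive_unique (f : R -> C) (t : R) (l l' : C) :
  is_Cderive f t l -> is_Cderive f t l' -> l = l'.
Proof.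
  intros [H1 H2] [H3 H4]; apply injective_projections.
  - rewrite <- (is_derive_unique _ _ _ H1); now apply is_derive_unique.
  - rewrite <- (is_derive_unique _ _ _ H2); now apply is_derive_unique.
Qed.

Lemma is_Cderive_ext_loc (f g : R -> C) (t : R) (l : C) :
  locally t (fun x => f x = g x) -> is_Cderive f t l -> is_Cderive g t l.
Proof.
  intros He [H1 H2]; split;
    (eapply is_derive_ext_loc; [|eassumption]);
    revert He; apply filter_imp; intros x ->; reflexivity.
Qed.

(* Once differentiability is known, the derivative comes from
   differentiating [rhp_sqrt (f x) ^ 2 = f x]. *)
Lemma is_Cderive_rhp_sqrt (f : R -> C) (t : R) (f' : C) :
  is_Cderive f t f' -> (0 < fst (f t))%R ->
  is_Cderive (fun x => rhp_sqrt (f x)) t (f' / (2 * rhp_sqrt (f t))).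
Proof.
  intros Hf H; destruct (ex_is_Cderive_rhp_sqrt f t f' Hf H) as [l Hl].
  replace (f' / (2 * rhp_sqrt (f t))) with l; [exact Hl|].
  assert (rhp_sqrt (f t) <> 0).
  { pose proof (rhp_sqrt_pos _ H) as Hp; intros E; rewrite E in Hp.
    simpl in Hp; lra. }
  replace f' with (l * rhp_sqrt (f t) + rhp_sqrt (f t) * l); [field; auto|].
  apply is_Cderive_unique with f t; [|exact Hf].
  apply is_Cderive_ext_loc with (fun x => rhp_sqrt (f x) * rhp_sqrt (f x));
    [|now apply is_Cderive_mult].
  (* The identity for the square holds where the real part is positive; by continuity this is a
     neighbourhood of [t]. *)
  assert (continuous (fun x => fst (f x)) t) as Hc.
  { apply (ex_derive_continuous (K := R_AbsRing) (V := R_NormedModule)); eexists; apply Hf. }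
  pose proof (Hc _ (open_gt 0%R _ H)) as Hn; unfold filtermap in Hn; revert Hn.
  apply filter_imp; intros x Hx; now apply rhp_sqrt_sqr.
Qed.

Lemma is_Cderive_rhp_ln (f : R -> C) (t : R) (f' : C) :
  is_Cderive f t f' -> (0 < fst (f t))%R ->
  is_Cderive (fun x => rhp_ln (f x)) t (f' / f t).
Proof.
  induction f as [u v] using path_ind.
  intros [H1 H2] H; cbn [fst snd] in *.
  pose proof (sqrt_ge_fst _ (v t) H) as Hge.
  assert (0 < u t ^ 2 + v t ^ 2)%R as Hn by nra.
  pose proof (sqrt_sqrt _ (Rlt_le _ _ Hn)) as Hsq.
  assert (Derive (fun x : R => u x) t = fst f') as D1
    by exact (is_derive_unique _ _ _ H1).
  assert (Derive (fun x : R => v x) t = snd f') as D2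
    by exact (is_derive_unique _ _ _ H2).
  simpl pow in *.
  split; unfold rhp_ln; simpl; auto_derive.
  all: try (repeat split; try (now (eexists; eassumption)); lra).
  all: rewrite D1, D2.
  - set (m := sqrt _) in *.
    assert (0 < m)%R by lra.
    transitivity ((fst f' * u t + snd f' * v t) / (m * m))%R; [field; lra|].
    rewrite Hsq; field; lra.
  - field; repeat split; lra.
Qed.

(** * Power series with complex coefficients at real points *)

(** The direction z is put into the coefficients and the variable t is real, so termwise
    differentiation and Abel's theorem for real power series apply to each part. *)
Definition CPS (a : nat -> C) (t : R) : C :=
  (PSeries (fun k => fst (a k)) t, PSeries (fun k => snd (a k)) t).

Lemma CV_radius_ge_1 (a : nat -> R) :
  (forall k, (Rabs (a k) <= 1)%R) -> Rbar_le 1 (CV_radius a).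
Proof.
  intros Ha; apply (CV_radius_bounded a); exists 1%R; intros k.
  rewrite pow1, Rmult_1_r; apply Ha.
Qed.

Lemma CV_radius_parts (a : nat -> C) (t : R) :
  (forall k, (Cmod (a k) <= 1)%R) -> (Rabs t < 1)%R ->
  Rbar_lt (Rabs t) (CV_radius (fun k => fst (a k))) /\
  Rbar_lt (Rabs t) (CV_radius (fun k => snd (a k))).
Proof.
  intros Ha Ht; split; apply Rbar_lt_le_trans with (Finite 1); try exact Ht;
    apply CV_radius_ge_1; intros k; apply Rle_trans with (2 := Ha k).
  - apply re_le_Cmod.
  - apply Rle_trans with (2 := Rmax_Cmod _), Rmax_r.
Qed.

Lemma is_series_CPS (a : nat -> C) (t : R) :
  Rbar_lt (Rabs t) (CV_radius (fun k => fst (a k))) ->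
  Rbar_lt (Rabs t) (CV_radius (fun k => snd (a k))) ->
  is_series (fun k => a k * t ^ k) (CPS a t).
Proof.
  intros H1 H2; apply is_series_pair.
  - apply is_series_ext with (fun k => fst (a k) * t ^ k)%R.
    { intros k; rewrite <- RtoC_pow; simpl; ring. }
    now apply is_pseries_R, PSeries_correct, CV_radius_inside.
  - apply is_series_ext with (fun k => snd (a k) * t ^ k)%R.
    { intros k; rewrite <- RtoC_pow; simpl; ring. }
    now apply is_pseries_R, PSeries_correct, CV_radius_inside.
Qed.

Definition CPS_derive (a : nat -> C) (k : nat) : C := INR (S k) * a (S k).

Lemma CPS_derive_parts (a : nat -> C) :
  (forall k, PS_derive (fun k => fst (a k)) k = fst (CPS_derive a k)) /\
  (forall k, PS_derive (fun k => snd (a k)) k = snd (CPS_derive a k)).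
Proof.
  split; intros k; unfold PS_derive, CPS_derive; cbn -[INR]; ring.
Qed.

Lemma is_Cderive_CPS (a : nat -> C) (t : R) :
  Rbar_lt (Rabs t) (CV_radius (fun k => fst (a k))) ->
  Rbar_lt (Rabs t) (CV_radius (fun k => snd (a k))) ->
  is_Cderive (CPS a) t (CPS (CPS_derive a) t) /\
  is_series (fun k => CPS_derive a k * t ^ k) (CPS (CPS_derive a) t).
Proof.
  intros H1 H2; destruct (CPS_derive_parts a) as [E1 E2]; split.
  - split; unfold CPS; cbn [fst snd].
    + rewrite <- (PSeries_ext _ _ t E1); now apply is_derive_PSeries.
    + rewrite <- (PSeries_ext _ _ t E2); now apply is_derive_PSeries.
  - apply is_series_CPS.
    + rewrite <- (CV_radius_ext _ _ E1), CV_radius_derive; exact H1.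
    + rewrite <- (CV_radius_ext _ _ E2), CV_radius_derive; exact H2.
Qed.

Lemma Cderive_zero_const (f : R -> C) (a b : R) :
  (forall x, (a <= x <= b)%R -> is_Cderive f x 0) -> (a < b)%R -> f a = f b.
Proof.
  intros H Hab; apply injective_projections.
  - apply (eq_is_derive (fun x => fst (f x))); [|exact Hab].
    intros x Hx; apply (H x Hx).
  - apply (eq_is_derive (fun x => snd (f x))); [|exact Hab].
    intros x Hx; apply (H x Hx).
Qed.

Lemma Re_gt_0_neq_0 (w : C) : (0 < fst w)%R -> w <> 0.
Proof. intros H E; rewrite E in H; simpl in H; lra. Qed.

Lemma C2_neq_0 : RtoC 2 <> 0.
Proof. apply Re_gt_0_neq_0; simpl; lra. Qed.

(** * Agreement with the principal branches *)

(** acos(x/m) is atan(|y|/x) for x > 0; the sign chosen in [Carg] restores that of y, since atan is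
    odd. *)
Lemma Carg_right (w : C) : (0 < fst w)%R -> Carg w = atan (snd w / fst w).
Proof.
  intros H; unfold Carg, Re, Im.
  pose proof (sqrt_ge_fst (fst w) (snd w) H) as Hm.
  fold (Cmod w) in Hm.
  assert (Cmod w * Cmod w = fst w ^ 2 + snd w ^ 2)%R as Hsq
    by (apply sqrt_sqrt; nra).
  set (m := Cmod w) in *; set (x := fst w) in *; set (y := snd w) in *.
  assert (sqrt (1 - (x / m)²) / (x / m) = Rabs y / x)%R as E1.
  { replace (1 - (x / m)²)%R with ((y / m)²)
      by (unfold Rsqr; field_simplify_eq; lra).
    rewrite sqrt_Rsqr_abs, Rabs_div, (Rabs_pos_eq m) by lra; field; lra. }
  rewrite acos_atan, E1 by (apply Rdiv_lt_0_compat; lra).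
  destruct (Rlt_dec y 0).
  - rewrite Rabs_left by lra; rewrite <- atan_opp; f_equal; field; lra.
  - now rewrite Rabs_pos_eq by lra.
Qed.

Lemma Cln_right (w : C) : (0 < fst w)%R -> Cln w = rhp_ln w.
Proof.
  intros H; unfold Cln, rhp_ln; rewrite Carg_right by exact H; reflexivity.
Qed.

(** Half-angle formulas: with th the argument, 2 cos^2(th/2) = 1 + x/m and 2 sin(th/2) cos(th/2) =
    y/m. *)
Lemma Csqrt_right (w : C) : (0 < fst w)%R -> Csqrt w = rhp_sqrt w.
Proof.
  intros H; unfold Csqrt; rewrite Carg_right by exact H.
  pose proof (rhp_sqrt_pos w H) as Hp0; revert Hp0.
  unfold rhp_sqrt; cbn [fst snd].
  pose proof (sqrt_ge_fst (fst w) (snd w) H) as Hm.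
  change (Cmod w) with (sqrt (fst w ^ 2 + snd w ^ 2)).
  assert (sqrt (fst w ^ 2 + snd w ^ 2) * sqrt (fst w ^ 2 + snd w ^ 2)
    = fst w ^ 2 + snd w ^ 2)%R as Hsq by (apply sqrt_sqrt; nra).
  set (m := sqrt (fst w ^ 2 + snd w ^ 2)) in *.
  set (x := fst w) in *; set (y := snd w) in *.
  set (th := atan (y / x)); intros Hp0.
  assert (sqrt (1 + (y / x)²) = m / x)%R as E1.
  { replace (1 + (y / x)²)%R with ((m / x)²)
      by (unfold Rsqr; field_simplify_eq; lra).
    apply sqrt_Rsqr, Rlt_le, Rdiv_lt_0_compat; lra. }
  assert (cos th = x / m)%R as Hc
    by (unfold th; rewrite cos_atan, E1; field; lra).
  assert (sin th = y / m)%R as Hs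
    by (unfold th; rewrite sin_atan, E1; field; lra).
  (* As th lies in (-pi/2, pi/2), this sign selects the positive root in [E2]. *)
  assert (0 < cos (th / 2))%R as Hc2.
  { pose proof (atan_bound (y / x)); pose proof PI_RGT_0.
    apply cos_gt_0; unfold th; lra. }
  replace th with (2 * (th / 2))%R in Hc, Hs by field.
  rewrite cos_2a_cos in Hc; rewrite sin_2a in Hs.
  assert (0 < sqrt m)%R as Hrm by (apply sqrt_lt_R0; lra).
  assert (sqrt m * sqrt m = m)%R as Hrm2 by (apply sqrt_sqrt; lra).
  set (c := cos (th / 2)) in *; set (s := sin (th / 2)) in *.
  assert (sqrt ((m + x) / 2) = sqrt m * c)%R as E2.
  { apply sqrt_lem_1; [lra|nra|].
    replace (sqrt m * c * (sqrt m * c))%R with (m * (2 * c * c) / 2)%R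
      by (transitivity (sqrt m * sqrt m * (c * c))%R; [rewrite Hrm2; field|ring]).
    replace (2 * c * c)%R with (x / m + 1)%R by lra; field; lra. }
  rewrite E2; apply injective_projections; simpl; [ring|].
  replace y with (2 * s * c * m)%R by (rewrite Hs; field; lra).
  clearbody m; set (r := sqrt m) in *; clearbody r; subst m; field; lra.
Qed.

(** At x = 0 the imaginary part is 0 times the inverse of 0, hence 0; this covers the branch point
    reached for z = 1. *)
Lemma rhp_sqrt_RtoC (x : R) : (0 <= x)%R -> rhp_sqrt (RtoC x) = sqrt x.
Proof.
  intros Hx; unfold rhp_sqrt, RtoC; cbn [fst snd].
  replace (x ^ 2 + 0 ^ 2)%R with (x ^ 2)%R by ring.
  rewrite sqrt_pow2 by lra; replace ((x + x) / 2)%R with x by field.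
  f_equal; unfold Rdiv; ring.
Qed.

Lemma rhp_ln_RtoC (x : R) : (0 < x)%R -> rhp_ln (RtoC x) = ln x.
Proof.
  intros Hx; unfold rhp_ln, RtoC; cbn [fst snd].
  replace (x ^ 2 + 0 ^ 2)%R with (x ^ 2)%R by ring.
  rewrite sqrt_pow2 by lra; unfold Rdiv; now rewrite Rmult_0_l, atan_0.
Qed.

Lemma Csqrt_0 : Csqrt 0 = rhp_sqrt 0.
Proof.
  rewrite rhp_sqrt_RtoC by lra; unfold Csqrt.
  rewrite Cmod_0, sqrt_0; ring.
Qed.

(** * The two series along the ray t z *)

Lemma Re_le_1 (z : C) : (Cmod z <= 1)%R -> (fst z <= 1)%R.
Proof.
  intros Hz; apply Rle_trans with (2 := Hz), Rle_trans with (1 := Rle_abs _), re_le_Cmod.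
Qed.

Lemma one_minus_pos (z : C) (t : R) :
  (Cmod z <= 1)%R -> (0 <= t < 1)%R -> (0 < fst (1 - z * t)%C)%R.
Proof. intros Hz Ht; apply Re_le_1 in Hz; simpl; nra. Qed.

(* On the unit circle only [z = 1] has real part 1. *)
Lemma one_minus_pos_at_1 (z : C) :
  (Cmod z <= 1)%R -> z <> 1 -> (0 < fst (1 - z * 1)%C)%R.
Proof.
  intros Hz H1; pose proof (Re_le_1 z Hz).
  destruct (Rle_lt_or_eq_dec _ _ H) as [|E]; [simpl; lra|].
  exfalso; apply H1; pose proof (Cmod2_alt z) as H2; unfold Re, Im in H2.
  pose proof (Cmod_ge_0 z).
  assert (snd z = 0)%R by nra.
  apply injective_projections; simpl; lra.
Qed.

Definition binom_coef (z : C) (k : nat) : C := central k * z ^ k.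

(** The coefficient at k = 0 vanishes because real division by 0 gives 0, so the series effectively
    starts at k = 1. *)
Definition log_coef (z : C) (k : nat) : C := RtoC (central k / INR k) * z ^ k.

Lemma Cmod_coef_le (c : R) (z : C) (k : nat) :
  (0 <= c <= 1)%R -> (Cmod z <= 1)%R -> (Cmod (c * z ^ k) <= 1)%R.
Proof.
  intros Hc Hz; rewrite Cmod_mult, Cmod_pow, Cmod_R, Rabs_pos_eq by lra.
  assert (Cmod z ^ k <= 1)%R.
  { rewrite <- (pow1 k); apply pow_incr; split; [apply Cmod_ge_0|lra]. }
  assert (0 <= Cmod z ^ k)%R by apply pow_le, Cmod_ge_0.
  nra.
Qed.

Lemma Cmod_binom_coef (z : C) (k : nat) :
  (Cmod z <= 1)%R -> (Cmod (binom_coef z k) <= 1)%R.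
Proof.
  intros Hz; apply Cmod_coef_le; [|exact Hz].
  split; [apply Rlt_le, central_pos|apply central_le_1].
Qed.

Lemma Cmod_log_coef (z : C) (k : nat) :
  (Cmod z <= 1)%R -> (Cmod (log_coef z k) <= 1)%R.
Proof.
  intros Hz; apply Cmod_coef_le; [|exact Hz].
  pose proof (central_pos k); pose proof (central_le_1 k).
  destruct k as [|k]; [simpl; unfold Rdiv; rewrite Rinv_0; lra|].
  rewrite S_INR; pose proof (pos_INR k); split.
  - apply Rlt_le, Rdiv_lt_0_compat; lra.
  - apply Rle_div_l; lra.
Qed.

Lemma CPS_0 (a : nat -> C) : CPS a 0 = a 0%nat.
Proof. unfold CPS; rewrite !PSeries_0; symmetry; apply surjective_pairing. Qed.

(** Restates an equality at type [C], so that [ring] and [field] recognise the carrier. *)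
Ltac to_C := match goal with |- ?x = ?y => change (@eq C x y) end.
Ltac Cring := to_C; ring.

(** With h the series, the recurrence 2(k+1) c_{k+1} = (2k+1) c_k, multiplied by z^{k+1} t^k and
    summed, reads 2h' = z h + 2 z t h'. *)
Lemma binom_coef_ode (z : C) (t : R) : (Cmod z <= 1)%R -> (Rabs t < 1)%R ->
  2 * (1 - z * t) * CPS (CPS_derive (binom_coef z)) t = z * CPS (binom_coef z) t.
Proof.
  intros Hz Ht.
  destruct (CV_radius_parts (binom_coef z) t) as [R1 R2];
    [intros k; now apply Cmod_binom_coef|exact Ht|].
  pose proof (is_series_CPS _ _ R1 R2) as Hh.
  destruct (is_Cderive_CPS _ _ R1 R2) as [_ Hd].
  set (h := CPS (binom_coef z) t) in *.
  set (d := CPS (CPS_derive (binom_coef z)) t) in *.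
  (* Multiplying h' by t shifts its coefficients by one place; the new term at k = 0 is 0. *)
  assert (is_series (fun k => INR k * binom_coef z k * t ^ k) (t * d)) as Htd.
  { apply is_series_decr_1.
    apply is_series_ext with (fun k => t * (CPS_derive (binom_coef z) k * t ^ k)).
    { intros k; unfold CPS_derive; rewrite Cpow_S; Cring. }
    match goal with |- is_series _ ?l => replace l with (t * d) end.
    { exact (is_series_scal_l (K := C_AbsRing) (V := C_NormedModule) (RtoC t) _ _ Hd). }
    change (t * d = t * d + - (INR 0 * binom_coef z 0 * t ^ 0)); simpl; ring. }
  assert (2 * d = z * h + 2 * z * (t * d)) as E.
  { apply is_series_C_unique with (fun k => 2 * (CPS_derive (binom_coef z) k * t ^ k)).
    - exact (is_series_scal_l (K := C_AbsRing) (V := C_NormedModule) (RtoC 2) _ _ Hd).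
    - pose proof (is_series_plus _ _ _ _
        (is_series_scal_l (K := C_AbsRing) (V := C_NormedModule) z _ _ Hh)
        (is_series_scal_l (K := C_AbsRing) (V := C_NormedModule) (2 * z) _ _ Htd)) as H.
      refine (is_series_ext _ _ _ _ H); intros k.
      change (z * (binom_coef z k * t ^ k) + 2 * z * (INR k * binom_coef z k * t ^ k)
        = 2 * (CPS_derive (binom_coef z) k * t ^ k)).
      unfold CPS_derive, binom_coef; rewrite Cpow_S, central_S.
      pose proof (pos_INR k).
      replace (RtoC (INR (S k)) * (RtoC (central k * ((2 * INR k + 1) / (2 * INR k + 2)))
        * (z * z ^ k))) with (RtoC (INR (S k) * (central k * ((2 * INR k + 1) / (2 * INR k + 2))))
        * (z * z ^ k)) by (rewrite RtoC_mult; ring).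
      replace (INR (S k) * (central k * ((2 * INR k + 1) / (2 * INR k + 2))))%R
        with (central k * (INR k + / 2))%R by (rewrite S_INR; field; lra).
      rewrite RtoC_mult, RtoC_plus, RtoC_inv by lra.
      to_C.
      field; apply C2_neq_0. }
  replace (2 * (1 - z * t) * d) with (2 * d - 2 * z * (t * d)) by ring.
  rewrite E; ring.
Qed.

Definition path_sqrt (z : C) (t : R) : C := rhp_sqrt (1 - z * t).

Lemma is_Cderive_line (z : C) (t : R) : is_Cderive (fun x => 1 - z * x) t (- z).
Proof. split; simpl; auto_derive; try exact I; ring. Qed.

Lemma is_Cderive_path_sqrt (z : C) (t : R) : (0 < fst (1 - z * t)%C)%R ->
  is_Cderive (path_sqrt z) t (- z / (2 * path_sqrt z t)).
Proof.
  intros H; apply (is_Cderive_rhp_sqrt (fun x => 1 - z * x)); [|exact H].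
  apply is_Cderive_line.
Qed.

Lemma path_sqrt_0 (z : C) : path_sqrt z 0 = 1.
Proof.
  unfold path_sqrt; replace (1 - z * 0) with (RtoC 1) by ring.
  rewrite rhp_sqrt_RtoC, sqrt_1 by lra; reflexivity.
Qed.

(** For h the series and s the root, (h s)' = (2 s^2 h' - z h)/(2s), which vanishes by the
    differential equation since s^2 = 1 - z t; at t = 0 the product is 1. *)
Lemma binom_series_mult_sqrt (z : C) (t : R) : (Cmod z <= 1)%R -> (0 < t < 1)%R ->
  CPS (binom_coef z) t * path_sqrt z t = 1.
Proof.
  intros Hz Ht.
  transitivity (CPS (binom_coef z) 0 * path_sqrt z 0).
  2: { rewrite CPS_0, path_sqrt_0; unfold binom_coef; rewrite central_0; simpl; ring. }
  symmetry; apply (Cderive_zero_const (fun x => CPS (binom_coef z) x * path_sqrt z x));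
    [|lra].
  intros x Hx.
  assert (0 < fst (1 - z * x)%C)%R as Hpos by (apply one_minus_pos; [exact Hz|lra]).
  assert (Rabs x < 1)%R as Hx1 by (rewrite Rabs_pos_eq; lra).
  destruct (CV_radius_parts (binom_coef z) x) as [R1 R2];
    [intros k; now apply Cmod_binom_coef|exact Hx1|].
  destruct (is_Cderive_CPS _ _ R1 R2) as [Hd _].
  pose proof (is_Cderive_mult _ _ _ _ _ Hd (is_Cderive_path_sqrt z x Hpos)) as H.
  pose proof (binom_coef_ode z x Hz Hx1) as Hode.
  pose proof (rhp_sqrt_sqr _ Hpos) as Hsq; fold (path_sqrt z x) in Hsq.
  assert (path_sqrt z x <> 0) as Hs0.
  { apply Re_gt_0_neq_0, rhp_sqrt_pos, Hpos. }
  set (s := path_sqrt z x) in *; set (h := CPS (binom_coef z) x) in *.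
  set (d := CPS (CPS_derive (binom_coef z)) x) in *.
  replace (RtoC 0) with (d * s + h * (- z / (2 * s))); [exact H|].
  transitivity ((2 * (s * s) * d - z * h) / (2 * s)).
  { field; exact Hs0. }
  rewrite Hsq, Hode; field; exact Hs0.
Qed.

(** The derivative d has coefficients c_{k+1} z^{k+1}, so 1 + t d = h = 1/s; then z t = 1 - s^2
    removes the division by t. *)
Lemma log_coef_derive (z : C) (t : R) : (Cmod z <= 1)%R -> (0 <= t < 1)%R ->
  CPS (CPS_derive (log_coef z)) t
  = z / (path_sqrt z t * (1 + path_sqrt z t)).
Proof.
  intros Hz Ht.
  assert (forall k, CPS_derive (log_coef z) k = binom_coef z (S k)) as E.
  { intros k; unfold CPS_derive, log_coef, binom_coef.
    rewrite Cmult_assoc, <- RtoC_mult; do 2 f_equal.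
    rewrite S_INR; pose proof (pos_INR k); field; lra. }
  destruct (Req_dec t 0) as [->|Ht0].
  (* At t = 0, where t cannot be divided out, both sides are z/2. *)
  { rewrite CPS_0, E, path_sqrt_0; unfold binom_coef.
    rewrite central_S, central_0; simpl INR.
    replace (1 * ((2 * 0 + 1) / (2 * 0 + 2)))%R with (/ 2)%R by field.
    rewrite RtoC_inv, Cpow_1_r by lra; field. }
  assert (0 < t < 1)%R as Ht01 by (destruct Ht as [[?|?] ?]; [lra|congruence]).
  assert (Rabs t < 1)%R as Ht1 by (rewrite Rabs_pos_eq; lra).
  destruct (CV_radius_parts (binom_coef z) t) as [R1 R2];
    [intros k; now apply Cmod_binom_coef|exact Ht1|].
  pose proof (is_series_CPS _ _ R1 R2) as Hh.
  destruct (CV_radius_parts (log_coef z) t) as [R3 R4];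
    [intros k; now apply Cmod_log_coef|exact Ht1|].
  destruct (is_Cderive_CPS _ _ R3 R4) as [_ Hd].
  pose proof (binom_series_mult_sqrt z t Hz Ht01) as Hs1.
  assert (0 < fst (1 - z * t)%C)%R as Hpos by (apply one_minus_pos; [exact Hz|lra]).
  pose proof (rhp_sqrt_sqr _ Hpos) as Hsq; fold (path_sqrt z t) in Hsq.
  pose proof (rhp_sqrt_pos _ Hpos) as Hsp; fold (path_sqrt z t) in Hsp.
  set (h := CPS (binom_coef z) t) in *.
  set (d := CPS (CPS_derive (log_coef z)) t) in *.
  set (s := path_sqrt z t) in *; clearbody s.
  assert (s <> 0) by now apply Re_gt_0_neq_0.
  assert (1 + s <> 0) by (apply Re_gt_0_neq_0; simpl; lra).
  assert (RtoC t <> 0) by (intros F; apply RtoC_inj in F; contradiction).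
  assert (h = 1 + t * d) as Ehd.
  { apply is_series_C_unique with (fun k => binom_coef z k * t ^ k); [exact Hh|].
    apply is_series_decr_1.
    match goal with |- is_series _ ?l => replace l with (t * d) end.
    - apply is_series_ext with (fun k => t * (CPS_derive (log_coef z) k * t ^ k)).
      { intros k; rewrite E, Cpow_S; Cring. }
      exact (is_series_scal_l (K := C_AbsRing) (V := C_NormedModule) (RtoC t) _ _ Hd).
    - change (t * d = 1 + t * d + - (binom_coef z 0 * t ^ 0)).
      unfold binom_coef; rewrite central_0; simpl; ring. }
  assert (d = (h - 1) / t) as -> by (rewrite Ehd; field; auto).
  assert (h = 1 / s) as -> by (rewrite <- Hs1; field; auto).
  assert (z = (1 - s * s) / t) as Ez by (rewrite Hsq; field; auto).
  rewrite Ez; field; auto.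
Qed.

Definition path_log (z : C) (t : R) : C := 2 * rhp_ln (2 / (1 + path_sqrt z t)).

(** Keeps the argument of the logarithm in the half plane where [rhp_ln] is smooth. *)
Lemma Re_2_div_pos (w : C) : (0 < fst w)%R -> (0 < fst (2 / w)%C)%R.
Proof.
  intros H; unfold Cdiv, Cinv; simpl.
  assert (0 < fst w * (fst w * 1) + snd w * (snd w * 1))%R by nra.
  match goal with |- (0 < ?g)%R =>
    replace g with (2 * (fst w / (fst w * (fst w * 1) + snd w * (snd w * 1))))%R
      by (field; lra) end.
  apply Rmult_lt_0_compat, Rdiv_lt_0_compat; lra.
Qed.

(** By the chain rule the derivative is -2 s'/(1+s) with s' = -z/(2s). *)
Lemma is_Cderive_path_log (z : C) (t : R) : (0 < fst (1 - z * t)%C)%R ->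
  is_Cderive (path_log z) t (z / (path_sqrt z t * (1 + path_sqrt z t))).
Proof.
  intros Hpos.
  pose proof (rhp_sqrt_pos _ Hpos) as Hsp; fold (path_sqrt z t) in Hsp.
  assert (path_sqrt z t <> 0) by now apply Re_gt_0_neq_0.
  assert (0 < fst (1 + path_sqrt z t)%C)%R as H1
    by (change (0 < 1 + fst (path_sqrt z t))%R; lra).
  assert (1 + path_sqrt z t <> 0) by now apply Re_gt_0_neq_0.
  pose proof (is_Cderive_plus _ _ _ _ _ (is_Cderive_const 1 t)
    (is_Cderive_path_sqrt z t Hpos)) as D1.
  pose proof (is_Cderive_mult _ _ _ _ _ (is_Cderive_const 2 t)
    (is_Cderive_inv _ _ _ D1 ltac:(assumption))) as D2.
  pose proof (is_Cderive_mult _ _ _ _ _ (is_Cderive_const 2 t)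
    (is_Cderive_rhp_ln _ _ _ D2 (Re_2_div_pos _ H1))) as D3.
  unfold path_log, Cdiv at 1; cbv beta in D3.
  match type of D3 with is_Cderive _ _ ?l =>
    replace (z / (path_sqrt z t * (1 + path_sqrt z t))) with l; [exact D3|] end.
  field; auto.
Qed.

Lemma log_series_open (z : C) (t : R) : (Cmod z <= 1)%R -> (0 < t < 1)%R ->
  CPS (log_coef z) t = path_log z t.
Proof.
  intros Hz Ht.
  assert (CPS (log_coef z) 0 - path_log z 0 = 0) as E0.
  { rewrite CPS_0; unfold path_log; rewrite path_sqrt_0.
    replace (2 / (1 + 1)) with (RtoC 1)
      by (field; apply Re_gt_0_neq_0; simpl; lra).
    rewrite rhp_ln_RtoC, ln_1 by lra; unfold log_coef; simpl INR.
    unfold Rdiv; rewrite Rinv_0, Rmult_0_r; ring. }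
  assert (CPS (log_coef z) t - path_log z t = 0) as E.
  { rewrite <- E0; symmetry.
    apply (Cderive_zero_const (fun x => CPS (log_coef z) x - path_log z x)); [|lra].
    intros x Hx.
    assert (Rabs x < 1)%R as Hx1 by (rewrite Rabs_pos_eq; lra).
    destruct (CV_radius_parts (log_coef z) x) as [R1 R2];
      [intros k; now apply Cmod_log_coef|exact Hx1|].
    destruct (is_Cderive_CPS _ _ R1 R2) as [Hd _].
    rewrite log_coef_derive in Hd by (auto; lra).
    pose proof (is_Cderive_minus _ _ _ _ _ Hd
      (is_Cderive_path_log z x (one_minus_pos z x Hz ltac:(lra)))) as H.
    match type of H with is_Cderive _ _ ?l => replace l with (RtoC 0) in H by ring end.
    exact H. }
  replace (CPS (log_coef z) t) with (CPS (log_coef z) t - path_log z t + path_log z t)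
    by ring.
  rewrite E; ring.
Qed.

(** * Passage to t = 1 *)

(** [Abel] speaks of the radius of convergence itself; if that exceeds 1, the point 1 is interior
    and continuity suffices. *)
Lemma Abel_at_1 (a : nat -> R) :
  Rbar_le 1 (CV_radius a) -> ex_pseries a 1%R ->
  filterlim (PSeries a) (at_left 1) (locally (PSeries a 1)).
Proof.
  intros H1 H2.
  destruct (Rbar_le_lt_or_eq_dec _ _ H1) as [Hlt|Heq].
  - assert (continuity_pt (PSeries a) 1) as Hc
      by (apply PSeries_continuity; rewrite Rabs_R1; exact Hlt).
    apply continuity_pt_filterlim in Hc.
    eapply filterlim_filter_le_1; [|exact Hc].
    apply filter_le_within.
  - pose proof (Abel a) as HA; rewrite <- Heq in HA.
    apply HA; simpl; auto; lra.
Qed.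

(** For z <> 1 the path is differentiable at t = 1. For z = 1 the root meets its branch point there,
    and a real formula valid for t <= 1 is used. *)
Lemma path_log_left_continuous (z : C) : (Cmod z <= 1)%R ->
  filterlim (fun t => fst (path_log z t)) (at_left 1) (locally (fst (path_log z 1))) /\
  filterlim (fun t => snd (path_log z t)) (at_left 1) (locally (snd (path_log z 1))).
Proof.
  intros Hz.
  destruct (Ceq_dec z 1) as [->|Hz1].
  - assert (forall t, (t <= 1)%R ->
      path_log 1 t = RtoC (2 * ln (2 * / (1 + sqrt (1 - t))))) as E.
    { intros t Ht; unfold path_log, path_sqrt.
      replace (1 - 1 * t) with (RtoC (1 - t)) by (rewrite RtoC_minus; ring).
      rewrite rhp_sqrt_RtoC by lra; pose proof (sqrt_pos (1 - t)).
      rewrite <- RtoC_plus, <- RtoC_div by lra.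
      rewrite rhp_ln_RtoC by (apply Rdiv_lt_0_compat; lra).
      now rewrite <- RtoC_mult. }
    (* Two-sided continuity holds because [sqrt] is 0 on negative reals. *)
    assert (continuous (fun t => (2 * ln (2 * / (1 + sqrt (1 - t))))%R) 1) as Hc.
    { pose proof (sqrt_pos (1 - 1)) as Hs.
      apply (continuous_mult (K := R_AbsRing)); [apply continuous_const|].
      apply (continuous_comp (fun t => (2 * / (1 + sqrt (1 - t)))%R) ln).
      - apply (continuous_mult (K := R_AbsRing)); [apply continuous_const|].
        apply (continuous_comp (fun t => (1 + sqrt (1 - t))%R) Rinv).
        + apply (continuous_plus (V := R_NormedModule)); [apply continuous_const|].
          apply (continuous_comp (fun t => (1 - t)%R) sqrt).
          * apply (continuous_minus (V := R_NormedModule));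
              [apply continuous_const|apply continuous_id].
          * apply continuous_sqrt.
        + apply continuous_Rinv; lra.
      - apply (ex_derive_continuous (K := R_AbsRing) (V := R_NormedModule)); exists (/ (2 * / (1 + sqrt (1 - 1))))%R.
        apply is_derive_ln, Rmult_lt_0_compat, Rinv_0_lt_compat; lra. }
    split.
    + rewrite E by lra.
      apply (filterlim_within_ext _ (fun t => (2 * ln (2 * / (1 + sqrt (1 - t))))%R)).
      { intros t Ht; rewrite E by lra; reflexivity. }
      eapply filterlim_filter_le_1; [|exact Hc]; apply filter_le_within.
    + rewrite E by lra.
      apply (filterlim_within_ext _ (fun _ => 0%R)).
      { intros t Ht; rewrite E by lra; reflexivity. }
      apply filterlim_const.
  - destruct (is_Cderive_path_log z 1 (one_minus_pos_at_1 z Hz Hz1)) as [H1 H2].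
    split; eapply filterlim_filter_le_1; try apply filter_le_within.
    + apply (ex_derive_continuous (K := R_AbsRing) (V := R_NormedModule));
        eexists; exact H1.
    + apply (ex_derive_continuous (K := R_AbsRing) (V := R_NormedModule));
        eexists; exact H2.
Qed.

Lemma left_limit_unique (f g : R -> R) (l l' : R) :
  (forall t, (0 < t < 1)%R -> f t = g t) ->
  filterlim f (at_left 1) (locally l) -> filterlim g (at_left 1) (locally l') ->
  l = l'.
Proof.
  intros He Hf Hg.
  apply (filterlim_locally_unique (K := R_AbsRing) (V := R_NormedModule)
    (F := at_left 1) f); [exact Hf|].
  refine (filterlim_ext_loc g f _ Hg).
  assert (0 < 1)%R as H01 by lra.
  exists (mkposreal 1 H01); intros t Ht Ht1; symmetry; apply He.
  unfold ball in Ht; simpl in Ht; unfold AbsRing_ball, abs, minus, plus, opp in Ht.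
  simpl in Ht; apply Rabs_def2 in Ht; lra.
Qed.

Lemma log_series (z : C) : (Cmod z <= 1)%R ->
  is_series (log_coef z) (2 * Cln (2 / (1 + Csqrt (1 - z)))).
Proof.
  intros Hz.
  (* The tail with alpha = 0 and N = 1 avoids the denominator at k = 0. *)
  assert (ex_series (log_coef z)) as [l Hl].
  { apply (ex_series_incr_1 (K := C_AbsRing) (V := C_NormedModule)).
    destruct (ex_series_tail 0 z 1 Hz) as [l Hl].
    exists (z * l).
    refine (is_series_ext _ _ _ _
      (is_series_scal_l (K := C_AbsRing) (V := C_NormedModule) z _ _ Hl)).
    intros k; change (z * (central (S k) / (0 + INR (S k)) * z ^ k) = log_coef z (S k)).
    unfold log_coef; rewrite RtoC_div, Cpow_S by (apply not_0_INR; lia).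
    rewrite Cplus_0_l; ring. }
  assert (l = CPS (log_coef z) 1) as El.
  { apply injective_projections; simpl; symmetry; apply is_series_unique.
    - refine (is_series_ext _ _ _ _ (is_series_fst _ _ Hl)).
      intros k; rewrite pow1; symmetry; apply Rmult_1_r.
    - refine (is_series_ext _ _ _ _ (is_series_snd _ _ Hl)).
      intros k; rewrite pow1; symmetry; apply Rmult_1_r. }
  assert (forall k, Rabs (fst (log_coef z k)) <= 1 /\ Rabs (snd (log_coef z k)) <= 1)%R as Hb.
  { intros k; pose proof (Rmax_Cmod (log_coef z k)); pose proof (Cmod_log_coef z k Hz).
    pose proof (Rmax_l (Rabs (fst (log_coef z k))) (Rabs (snd (log_coef z k)))).
    pose proof (Rmax_r (Rabs (fst (log_coef z k))) (Rabs (snd (log_coef z k)))).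
    lra. }
  destruct (path_log_left_continuous z Hz) as [C1 C2].
  (* Both are left limits at 1 of the same function: one by Abel's theorem, the other by continuity
     of the closed form. *)
  assert (l = path_log z 1) as ->.
  { rewrite El; apply injective_projections.
    - refine (left_limit_unique _ _ _ _ _ (Abel_at_1 _ _ _) C1).
      + intros t Ht; exact (f_equal fst (log_series_open z t Hz Ht)).
      + apply CV_radius_ge_1; intros k; apply Hb.
      + exists (fst l); apply is_pseries_R.
        refine (is_series_ext _ _ _ _ (is_series_fst _ _ Hl)).
        intros k; rewrite pow1; symmetry; apply Rmult_1_r.
    - refine (left_limit_unique _ _ _ _ _ (Abel_at_1 _ _ _) C2).
      + intros t Ht; exact (f_equal snd (log_series_open z t Hz Ht)).
      + apply CV_radius_ge_1; intros k; apply Hb.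
      + exists (snd l); apply is_pseries_R.
        refine (is_series_ext _ _ _ _ (is_series_snd _ _ Hl)).
        intros k; rewrite pow1; symmetry; apply Rmult_1_r. }
  replace (2 * Cln (2 / (1 + Csqrt (1 - z)))) with (path_log z 1); [exact Hl|].
  unfold path_log, path_sqrt; replace (1 - z * 1) with (1 - z) by ring.
  assert (Csqrt (1 - z) = rhp_sqrt (1 - z) /\ (0 <= fst (rhp_sqrt (1 - z)%C))%R)
    as [-> Hs].
  (* For z = 1 the root is taken at 0, on the boundary of the half plane. *)
  { destruct (Ceq_dec z 1) as [->|Hz1].
    - replace (RtoC 1 - RtoC 1) with (RtoC 0) by ring; split; [apply Csqrt_0|].
      apply sqrt_pos.
    - pose proof (one_minus_pos_at_1 z Hz Hz1) as H.
      replace (1 - z * 1) with (1 - z) in H by ring.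
      split; [now apply Csqrt_right|now apply Rlt_le, rhp_sqrt_pos]. }
  rewrite Cln_right; [reflexivity|].
  apply Re_2_div_pos.
  change (0 < 1 + fst (rhp_sqrt (1 - z)%C))%R; lra.
Qed.

(** * Splitting the series and assembling the identity *)

Lemma is_series_split (a : nat -> C) (n : nat) (r s : C) :
  (1 <= n)%nat -> a 0%nat = 0 ->
  is_series (fun m => a (S n + m)%nat) r -> is_series a s ->
  sum_n_m a 1 n = - r + s.
Proof.
  intros Hn H0 Hr Hs.
  assert (s = r + sum_n a n) as Es.
  { apply is_series_C_unique with a; [exact Hs|].
    apply (is_series_decr_n a (S n)); [lia|].
    match goal with |- is_series _ ?l => replace l with r; [exact Hr|] end.
    simpl Nat.pred; change (r = r + sum_n a n + - sum_n a n); ring. }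
  rewrite Es; unfold sum_n.
  rewrite (sum_n_m_Chasles a 0 0 n) by lia.
  rewrite (sum_n_n a 0), H0.
  generalize (sum_n_m a 1 n : C); intros x.
  change (x = - r + (r + (0 + x))); ring.
Qed.

Theorem theorem2 (alpha z : C) (n : nat)
    (Halpha : forall j : nat, (1 <= j)%nat -> alpha <> - INR j)
    (Hz : (Cmod z <= 1)%R)
    (Hn : (1 <= n)%nat) :
  hypergeom_converges
    [RtoC 1; 3 / 2 + INR n; 1 + alpha + INR n]
    [2 + INR n; 2 + alpha + INR n] z /\
  (alpha <> 0 -> hypergeom_converges [RtoC (1 / 2); alpha] [1 + alpha] z) /\
  sum_n_m (fun k : nat =>
      Binomial.C (2 * k) k * (1 / (alpha + INR k)) * (z / 4) ^ k) 1 n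
  = - (INR (double_fact (1 + 2 * n)) / INR (double_fact (2 + 2 * n)))
      * (z ^ (1 + n) / (1 + alpha + INR n))
      * hypergeom
          [RtoC 1; 3 / 2 + INR n; 1 + alpha + INR n]
          [2 + INR n; 2 + alpha + INR n] z
    + E alpha z.
Proof.
  (* The value 0 at k = 0 lets one series serve both cases of [E], including alpha = 0, where the
     formula has a zero denominator. *)
  set (a := fun k : nat => match k with O => RtoC 0 | S _ =>
    central k / (alpha + INR k) * z ^ k end).
  assert (forall x : R, (0 < x)%R -> RtoC x <> 0) as Hpos
    by (intros x Hx; now apply Re_gt_0_neq_0).
  pose proof (Hpos _ (central_pos (S n))) as Hc.
  assert (1 + alpha + INR n <> 0) as Han.
  { intros H; apply (Halpha (S n)); [lia|].
    rewrite S_INR, RtoC_plus.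
    replace alpha with (1 + alpha + INR n - (INR n + 1)) by ring; rewrite H; ring. }
  destruct (ex_series_tail alpha z (S n) Hz) as [r Hr]; change C in r.
  (* The factor from tail terms to 3F2 terms; it is the inverse of c_{n+1}/(1+alpha+n), so the
     prefactor cancels it and leaves z^{n+1} r. *)
  set (q := (1 + alpha + INR n) / central (S n)).
  assert (is_series (hypergeom_term [RtoC 1; 3 / 2 + INR n; 1 + alpha + INR n]
    [2 + INR n; 2 + alpha + INR n] z) (q * r)) as H3.
  { refine (is_series_ext _ _ _ _
      (is_series_scal_l (K := C_AbsRing) (V := C_NormedModule) q _ _ Hr)).
    intros m.
    change (q * (central (S n + m) / (alpha + INR (S n + m)) * z ^ m)
      = hypergeom_term [RtoC 1; 3 / 2 + INR n; 1 + alpha + INR n]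
          [2 + INR n; 2 + alpha + INR n] z m).
    set (h := hypergeom_term _ _ _ _).
    replace h with (RtoC (central (S n)) * h / central (S n)) by (field; exact Hc).
    unfold h; rewrite hypergeom_term_3F2 by exact Halpha.
    unfold q, Cdiv; ring. }
  assert (alpha <> 0 -> exists s : C,
    is_series (hypergeom_term [RtoC (1 / 2); alpha] [1 + alpha] z) (1 + alpha * s)
    /\ is_series a s) as H2.
  { intros Ha0; destruct (ex_series_tail alpha z 0 Hz) as [s Hs]; change C in s.
    (* 1/alpha is the k = 0 term of the full series, absent from [a]. *)
    exists (s - 1 / alpha); split.
    - replace (1 + alpha * (s - 1 / alpha)) with (alpha * s) by (field; exact Ha0).
      refine (is_series_ext _ _ _ _
        (is_series_scal_l (K := C_AbsRing) (V := C_NormedModule) alpha _ _ Hs)).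
      intros m; symmetry; now apply hypergeom_term_2F1.
    - apply is_series_decr_1.
      apply (is_series_incr_1 (fun m => central (0 + m) / (alpha + INR (0 + m)) * z ^ m)).
      match goal with |- is_series _ ?l => replace l with s; [exact Hs|] end.
      change (s = s - 1 / alpha + - 0
        + central 0 / (alpha + INR 0) * z ^ 0).
      rewrite central_0; simpl; rewrite Cplus_0_r; field; exact Ha0. }
  split; [now exists (q * r)|split].
  { intros Ha0; destruct (H2 Ha0) as [s [Hs _]]; now exists (1 + alpha * s). }
  rewrite (hypergeom_unique _ _ _ _ H3).
  (* In both cases [E alpha z] is the whole sum over k >= 1, so the finite sum is [E alpha z] minus
     the tail. *)
  assert (is_series a (E alpha z)) as HE.
  { unfold E; destruct (Ceq_dec alpha 0) as [Ha0|Ha0].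
    - refine (is_series_ext _ _ _ _ (log_series z Hz)).
      intros [|k]; unfold log_coef, a; simpl INR.
      + unfold Rdiv; rewrite Rinv_0, Rmult_0_r; apply Cmult_0_l.
      + rewrite Ha0, RtoC_div by (apply (not_0_INR (S k)); lia).
        now rewrite Cplus_0_l.
    - destruct (H2 Ha0) as [s [Hs1 Hs2]].
      rewrite (hypergeom_unique _ _ _ _ Hs1).
      replace (1 / alpha * (1 + alpha * s - 1)) with s by (field; exact Ha0).
      exact Hs2. }
  rewrite <- !RtoC_div by (apply not_0_INR, double_fact_neq_0).
  rewrite double_fact_ratio.
  rewrite (sum_n_m_ext_loc _ a).
  - rewrite (is_series_split a n (z ^ S n * r) (E alpha z)); auto.
    + f_equal; unfold q; simpl (1 + n)%nat; field; auto.
    + refine (is_series_ext _ _ _ _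
        (is_series_scal_l (K := C_AbsRing) (V := C_NormedModule) (z ^ S n) _ _ Hr)).
      intros m; change (z ^ S n * (central (S n + m) / (alpha + INR (S n + m)) * z ^ m)
        = central (S n + m) / (alpha + INR (S n + m)) * z ^ (S n + m)).
      rewrite Cpow_add_r; ring.
  - intros [|k] Hk; [lia|]; unfold a.
    unfold central; rewrite RtoC_div, RtoC_pow by (apply pow_nonzero; lra).
    unfold Cdiv; rewrite Cpow_mult_l, Cpow_inv by (apply Hpos; lra); Cring.
Qed.
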